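(* Let $R$ be an associative ring with identity $1$ and a non-trivial idempotent $e$, put $e_1=e$, $e_2=1-e$, $R_{ij}=e_iRe_j$ for $i,j\in\{1,2\}$, and assume that for all $i,j,k\in\{1,2\}$ and every $a_{ij}\in R_{ij}$: if $a_{ij}x_{jk}=0$ for all $x_{jk}\in R_{jk}$, then $a_{ij}=0$. If $\varphi:R\to R$ is a multiplicative automorphism of $R$, then $\varphi$ is additive. Moreover, $\varphi$ is an automorphism of $R$.
   Context: Rings are associative and not assumed commutative. A non-trivial idempotent is an element $e$ with $e^2=e$, $e\neq 0$, $e\neq 1$. A map $f:R\to R$ is additive if $f(a+b)=f(a)+f(b)$ for all $a,b\in R$. A multiplicative automorphism of $R$ is a bijective map $\varphi:R\to R$ with $\varphi(ab)=\varphi(a)\varphi(b)$ for all $a,b\in R$ (additivity not assumed); an automorphism is an additive multiplicative automorphism. *)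

(* Defs.v *)
From mathcomp Require Import all_boot all_algebra.

Set Implicit Arguments.
Unset Strict Implicit.
Unset Printing Implicit Defensive.

Import GRing.Theory.
Local Open Scope ring_scope.

Definition nontrivial_idempotent (R : pzRingType) (e : R) : Prop :=
  [/\ e * e = e, e <> 0 & e <> 1].

(* The index set {1, 2} is encoded as 'I_2 = {0, 1}: index 0 is e_1 = e and
   index 1 is e_2 = 1 - e. *)
Definition peirce_idem (R : pzRingType) (e : R) (i : 'I_2) : R :=
  if i == ord0 then e else 1 - e.

(* Membership in R_ij = e_i R e_j. *)
Definition in_peirce (R : pzRingType) (e : R) (i j : 'I_2) (a : R) : Prop :=
  exists r : R, a = peirce_idem e i * r * peirce_idem e j.

(* Only addition is required to be preserved, unlike [nmod_morphism], which
   also asks for f 0 = 0. *)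
Definition additive_map (R : pzRingType) (f : R -> R) : Prop :=
  {morph f : a b / a + b}.

(* Unlike [monoid_morphism], this does not require f 1 = 1. *)
Definition multiplicative_automorphism (R : pzRingType) (f : R -> R) : Prop :=
  bijective f /\ {morph f : a b / a * b}.

Definition ring_automorphism (R : pzRingType) (f : R -> R) : Prop :=
  additive_map f /\ multiplicative_automorphism f.

(* Main.v *)
(* The map phi is split along the Peirce decomposition.  If phi c = phi a + phi b
   then multiplying by idempotents (on one side) recovers the Peirce components of
   c, so phi is additive on sums whose two terms lie in different Peirce rows or
   columns.  On R_12, the identity a + b = (e_1 + a)(e_2 + b) reduces additivity to
   such sums.  On R_11, the elements c and a + b act in the same way on R_12, so
   the annihilator hypothesis makes them equal. *)
Require Import Defs.
From mathcomp Require Import all_boot all_algebra.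

Import GRing.Theory.
Local Open Scope ring_scope.

Lemma idemC (R : pzRingType) (e : R) :
  e * e = e -> (1 - e) * (1 - e) = 1 - e.
Proof. by move=> ee; rewrite mulrBr mulr1 mulrBl mul1r ee subrr subr0. Qed.

Lemma mul_idemC (R : pzRingType) (e : R) : e * e = e -> e * (1 - e) = 0.
Proof. by move=> ee; rewrite mulrBr mulr1 ee subrr. Qed.

Lemma mul_Cidem (R : pzRingType) (e : R) : e * e = e -> (1 - e) * e = 0.
Proof. by move=> ee; rewrite mulrBl mul1r ee subrr. Qed.

Lemma mul_idem_split (R : pzRingType) (e a : R) : a = a * e + a * (1 - e).
Proof. by rewrite -mulrDr addrC subrK mulr1. Qed.

Lemma idem_mul_split (R : pzRingType) (e a : R) : a = e * a + (1 - e) * a.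
Proof. by rewrite -mulrDl addrC subrK mul1r. Qed.

(** Surjectivity replaces additivity: [0] absorbs a preimage of [0]. *)
Lemma multiplicative_automorphism0 (R : pzRingType) (phi : R -> R) :
  multiplicative_automorphism phi -> phi 0 = 0.
Proof.
by case=> -[psi _ psiK] phiM; have := phiM 0 (psi 0); rewrite mul0r psiK mulr0.
Qed.

(** Right multiplication by [phi e] keeps the first summand and sends the second to [phi 0 = 0];
    [phi (1 - e)] does the opposite. So [psi s] has the columns [a * e] and [b * (1 - e)]. *)
Lemma additive_distinct_columns (R : pzRingType) (phi : R -> R) (e a b : R) :
  multiplicative_automorphism phi -> e * e = e ->
  phi (a * e + b * (1 - e)) = phi (a * e) + phi (b * (1 - e)).
Proof.
move=> hphi ee; have phi0 := multiplicative_automorphism0 _ _ hphi.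
case: hphi => -[psi phiK psiK] phiM.
set s := _ + phi _; rewrite -[s]psiK; congr phi.
rewrite [RHS](mul_idem_split _ e); congr (_ + _);
  apply: (can_inj phiK); rewrite [RHS]phiM psiK mulrDl -!phiM -!mulrA.
- by rewrite ee mul_Cidem // mulr0 phi0 addr0.
- by rewrite idemC // mul_idemC // mulr0 phi0 add0r.
Qed.

Lemma additive_distinct_rows (R : pzRingType) (phi : R -> R) (e a b : R) :
  multiplicative_automorphism phi -> e * e = e ->
  phi (e * a + (1 - e) * b) = phi (e * a) + phi ((1 - e) * b).
Proof.
move=> hphi ee; have phi0 := multiplicative_automorphism0 _ _ hphi.
case: hphi => -[psi phiK psiK] phiM.
set s := _ + phi _; rewrite -[s]psiK; congr phi.
rewrite [RHS](idem_mul_split _ e); congr (_ + _);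
  apply: (can_inj phiK); rewrite [RHS]phiM psiK mulrDr -!phiM !mulrA.
- by rewrite ee mul_idemC // mul0r phi0 addr0.
- by rewrite idemC // mul_Cidem // mul0r phi0 add0r.
Qed.

Lemma additive_offdiag (R : pzRingType) (phi : R -> R) (e a b : R) :
  multiplicative_automorphism phi -> e * e = e ->
  phi (e * a * (1 - e) + e * b * (1 - e))
    = phi (e * a * (1 - e)) + phi (e * b * (1 - e)).
Proof.
move=> hphi ee; have phiM := hphi.2.
have phi0 := multiplicative_automorphism0 _ _ hphi.
set u := e * a * _; set v := e * b * _.
have uf : u * (1 - e) = u by rewrite /u -mulrA idemC.
have ev : e * v = v by rewrite /v !mulrA ee.
have ef : e * (1 - e) = 0 by exact: mul_idemC.
have uv : u * v = 0 by rewrite -uf -ev -mulrA (mulrA _ e) mul_Cidem // mul0r mulr0.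
have -> : u + v = (e + u) * (v + (1 - e)).
  by rewrite mulrDl (mulrDr e) (mulrDr u) ev ef uv uf addr0 add0r addrC.
(* Reading [e] as [e * e] and [u] as [u * (1 - e)] puts the first factor in two distinct columns;
   the second factor is likewise spread over two distinct rows. *)
rewrite phiM -{1}ee -{1}uf additive_distinct_columns // ee uf.
rewrite -{1}ev -{1}[1 - e]mulr1 additive_distinct_rows // ev mulr1.
by rewrite mulrDl (mulrDr (phi e)) (mulrDr (phi u)) -!phiM ev ef uv uf phi0 addr0 add0r addrC.
Qed.

Lemma additive_diag (R : pzRingType) (phi : R -> R) (e a b : R) :
  multiplicative_automorphism phi -> e * e = e ->
  (forall c : R, (forall x : R, e * c * e * (e * x * (1 - e)) = 0) ->
     e * c * e = 0) ->
  phi (e * a * e + e * b * e) = phi (e * a * e) + phi (e * b * e).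
Proof.
move=> hphi ee faithful; have [[psi phiK psiK] phiM] := hphi.
set u := e * a * e; set v := e * b * e.
pose c := psi (phi u + phi v); have phic : phi c = phi u + phi v by exact: psiK.
have euve : e * (u + v) * e = u + v.
  by rewrite mulrDr mulrDl /u /v !mulrA ee -!mulrA ee.
(* Multiplying by [phi e] on both sides fixes [phi u + phi v], so its preimage [c] lies in [eRe],
   where [faithful] applies. *)
have ece : e * c * e = c.
  apply: (can_inj phiK); rewrite !phiM phic mulrDr mulrDl -!phiM.
  by rewrite /u /v !mulrA ee -!mulrA ee.
rewrite -phic; congr phi; apply/esym/eqP.
rewrite -subr_eq0 -ece -euve -mulrBl -mulrBr; apply/eqP/faithful => x.
rewrite mulrBr mulrBl ece euve mulrBl; apply/eqP; rewrite subr_eq0; apply/eqP.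
(* After applying [phi], both products with [x] are sums over [eR(1 - e)], where additivity is
   known. *)
apply: (can_inj phiK); rewrite phiM phic !mulrDl -!phiM.
have -> : u * (e * x * (1 - e)) = e * (a * e * (e * x)) * (1 - e).
  by rewrite /u !mulrA.
have -> : v * (e * x * (1 - e)) = e * (b * e * (e * x)) * (1 - e).
  by rewrite /v !mulrA.
by rewrite additive_offdiag.
Qed.

Lemma additive_row (R : pzRingType) (phi : R -> R) (e a b : R) :
  multiplicative_automorphism phi -> e * e = e ->
  (forall c : R, (forall x : R, e * c * e * (e * x * (1 - e)) = 0) ->
     e * c * e = 0) ->
  phi (e * a + e * b) = phi (e * a) + phi (e * b).
Proof.
move=> hphi ee faithful.
have split y : phi y = phi (y * e) + phi (y * (1 - e)).
  by rewrite {1}(mul_idem_split _ e y) additive_distinct_columns.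
rewrite split !mulrDl additive_diag // additive_offdiag //.
by rewrite (split (e * a)) (split (e * b)) addrACA.
Qed.

Theorem theorem2p1 (R : pzRingType) (e : R)
    (he : nontrivial_idempotent e)
    (hR : forall (i j k : 'I_2) (a : R), in_peirce e i j a ->
            (forall x : R, in_peirce e j k x -> a * x = 0) -> a = 0)
    (phi : R -> R) (hphi : multiplicative_automorphism phi) :
  additive_map phi /\ ring_automorphism phi.
Proof.
suff phiD : additive_map phi by [].
have [ee _ _] := he.
(* The annihilator condition for (i, j, k) = (1, 1, 2), then for (2, 2, 1): one for each row. *)
have faithful1 c : (forall x, e * c * e * (e * x * (1 - e)) = 0) -> e * c * e = 0.
  by move=> ann; apply: (hR ord0 ord0 ord_max); [exists c | move=> _ [x ->]].
have faithful2 c : (forall x, (1 - e) * c * (1 - e) * ((1 - e) * x * e) = 0) ->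
    (1 - e) * c * (1 - e) = 0.
  by move=> ann; apply: (hR ord_max ord_max ord0); [exists c | move=> _ [x ->]].
have split y : phi y = phi (e * y) + phi ((1 - e) * y).
  by rewrite {1}(idem_mul_split _ e y) additive_distinct_rows.
move=> a b; rewrite split !mulrDr additive_row // additive_row //.
- by rewrite (split a) (split b) addrACA.
- exact: idemC.
(* For the idempotent [1 - e], the complement appears as [1 - (1 - e)]; only the trailing [e] has to
   be rewritten so. *)
- by move=> c ann; apply: faithful2 => x; rewrite -{4}[e](subKr 1) ann.
Qed.
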